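(* Let $X$ be the completion of the space $c_{00}$ of finitely supported real sequences with respect to the norm $\|x\|=\sup_{S}\left|\sum_{i\in S}x_i\right|$, where the supremum is taken over all finite intervals $S\subset\mathbb{N}$. Then $X$ has the fixed point property; that is, for every nonempty weakly compact convex subset $K$ of $X$ and every non-expansive mapping $T:K\to K$, there exists $x\in K$ with $Tx=x$.
   Context: $\mathbb{N}=\{1,2,3,\dots\}$, and $c_{00}$ is the real vector space of all finitely supported real sequences $x=(x_i)_{i\in\mathbb{N}}$. An interval $S\subset\mathbb{N}$ is a set of consecutive positive integers. A mapping $T:K\to K$ on a subset $K$ of a Banach space is non-expansive if $\|Tx-Ty\|\le\|x-y\|$ for all $x,y\in K$. A (nonempty) weakly compact convex set $K$ has the fixed point property if every non-expansive map $T:K\to K$ has a fixed point; a Banach space has the fixed point property if every (nonempty) weakly compact convex subset of it has the fixed point property. *)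

(* Defs.v *)
From HB Require Import structures.
From mathcomp Require Import all_boot all_order all_algebra.
From mathcomp Require Import all_classical all_reals all_analysis.
Import Order.TTheory GRing.Theory Num.Theory.
Import numFieldNormedType.Exports.

Set Implicit Arguments.
Unset Strict Implicit.
Unset Printing Implicit Defensive.

Local Open Scope classical_set_scope.
Local Open Scope ring_scope.

(* The index i : nat stands for the positive integer i.+1. *)
Definition finsupp_seq (R : realType) : {pred nat -> R} :=
  mem [set x : nat -> R | finite_set [set i | x i != 0]].

Definition c00 (R : realType) : Type := {x : nat -> R | x \in @finsupp_seq R}.

HB.instance Definition _ (R : realType) := SubType.on (c00 R).
HB.instance Definition _ (R : realType) := [Choice of c00 R by <:].

Lemma finsupp_seq_submod_closed (R : realType) :
  submod_closed (@finsupp_seq R).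
Proof.
split=> [|a x y]; rewrite !inE /=.
  by apply: (sub_finite_set _ (finite_set0 nat)) => i /=; rewrite eqxx.
move=> fx fy; apply: (sub_finite_set (B := [set i | x i != 0] `|`
  [set i | y i != 0])); last by rewrite finite_setU.
move=> i /=; have [x0|] := eqVneq (x i) 0; last by left.
have [y0|] := eqVneq (y i) 0; last by right.
have -> : (a *: x + y) i = a * x i + y i by [].
by rewrite x0 y0 mulr0 addr0 eqxx.
Qed.

HB.instance Definition _ (R : realType) :=
  GRing.isSubmodClosed.Build _ _ (@finsupp_seq R)
    (@finsupp_seq_submod_closed R).
HB.instance Definition _ (R : realType) :=
  [SubChoice_isSubLmodule of c00 R by <:].

Section interval_norm.
Variable R : realType.
Implicit Types x y : c00 R.

(* The finite intervals of consecutive integers are the {m, ..., n - 1}; the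
   empty one (n <= m) only adds the value 0, which does not change the sup. *)
Definition interval_sums x : set R :=
  [set `|\sum_(m <= i < n) val x i| | m in [set: nat] & n in [set: nat]].

Definition interval_norm x : R := sup (interval_sums x).

Lemma has_sup_interval_sums x : has_sup (interval_sums x).
Proof.
split; first by exists `|\sum_(0 <= i < 0) val x i|; exists 0%N => //; exists 0%N.
have: finite_set [set i | val x i != 0] by have := valP x; rewrite inE.
move=> /finite_seqP[A /seteqP[sA _]].
exists (\sum_(i <- undup A) `|val x i|) => _ [m _] [n _ <-].
apply: le_trans (ler_norm_sum _ _ _) _.
rewrite (bigID (fun i => i \in A)) /= [X in _ + X]big1 ?addr0; last first.
  move=> i iA; apply/eqP; rewrite normr_eq0; apply: contraNT iA => xi.
  exact: sA.
rewrite -big_filter; set s := seq.filter _ _.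
have us : uniq s by rewrite filter_uniq// iota_uniq.
rewrite [leRHS](bigID (fun i => i \in s)) /=.
rewrite -[leLHS]addr0 lerD ?sumr_ge0// -big_filter.
rewrite (perm_big [seq i <- undup A | i \in s]) ?big_filter//=.
rewrite filter_predT; apply: uniq_perm => //.
  by rewrite filter_uniq// undup_uniq.
by move=> i; rewrite !mem_filter mem_undup andbAC; case: (i \in A); rewrite ?andbF.
Qed.

Lemma interval_norm_ub x m n :
  `|\sum_(m <= i < n) val x i| <= interval_norm x.
Proof.
by apply: sup_upper_bound; [exact: has_sup_interval_sums|exists m => //; exists n].
Qed.

Lemma interval_norm_le x r :
  (forall m n, `|\sum_(m <= i < n) val x i| <= r) -> interval_norm x <= r.
Proof.
move=> h; apply: ge_sup; first by have [] := has_sup_interval_sums x.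
by move=> _ [m _] [n _ <-].
Qed.

Lemma interval_normD x y :
  interval_norm (x + y) <= interval_norm x + interval_norm y.
Proof.
apply: interval_norm_le => m n.
have -> : \sum_(m <= i < n) val (x + y) i =
    \sum_(m <= i < n) val x i + \sum_(m <= i < n) val y i.
  by rewrite -big_split.
by apply: le_trans (ler_normD _ _) _; rewrite lerD ?interval_norm_ub.
Qed.

Let interval_normZ_le (a : R) x :
  interval_norm (a *: x) <= `|a| * interval_norm x.
Proof.
apply: interval_norm_le => m n.
have -> : \sum_(m <= i < n) val (a *: x) i = a * \sum_(m <= i < n) val x i.
  by rewrite mulr_sumr.
by rewrite normrM ler_wpM2l ?interval_norm_ub.
Qed.

Lemma interval_normZ (a : R) x :
  interval_norm (a *: x) = `|a| * interval_norm x.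
Proof.
apply/eqP; rewrite eq_le interval_normZ_le /=.
have [->|a0] := eqVneq a 0.
  rewrite normr0 mul0r; apply: le_trans (interval_norm_ub _ 0 0).
  exact: normr_ge0.
rewrite mulrC -ler_pdivlMr ?normr_gt0// mulrC -normfV.
by rewrite -[in leLHS](scalerK a0 x) interval_normZ_le.
Qed.

Lemma interval_norm0_eq0 x : interval_norm x = 0 -> x = 0.
Proof.
move=> x0; apply: val_inj; apply/funext => i.
have := interval_norm_ub x i i.+1.
by rewrite x0 big_nat1 normr_le0 => /eqP.
Qed.

HB.instance Definition _ := Lmodule_isNormed.Build R (c00 R)
  interval_normD interval_normZ interval_norm0_eq0.

End interval_norm.

Definition is_completion (R : realType) (V : normedModType R)
    (X : completeNormedModType R) (j : {linear V -> X}) : Prop :=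
  (forall v, `|j v| = `|v|) /\ dense (range j).

Definition topological_dual (R : realType) (X : normedModType R) : Type :=
  {f : {scalar X} | continuous (f : X -> R)}.

(* X with the coarsest topology for which every f in the dual is continuous *)
Definition weak_space (R : realType) (X : normedModType R) : Type :=
  sup_topology (fun f : topological_dual X =>
    Topological.on (initial_topology (sval f : X -> R))).

HB.instance Definition _ (R : realType) (X : normedModType R) :=
  Topological.on (weak_space X).

Definition weakly_compact (R : realType) (X : normedModType R) (K : set X) :=
  compact (K : set (weak_space X)).

Definition nonexpansive_on (R : realType) (X : normedModType R) (K : set X)
    (T : X -> X) : Prop :=
  forall x y, K x -> K y -> `|T x - T y| <= `|x - y|.

Definition set_fixed_point_property (R : realType) (X : normedModType R)
    (K : set X) : Prop :=
  forall T : {fun K >-> K}, nonexpansive_on K T ->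
    exists2 x, K x & T x = x.

Definition fixed_point_property (R : realType) (X : completeNormedModType R) :
    Prop :=
  forall K : set X, K !=set0 -> weakly_compact K ->
    convex_set (K : set (convex_lmodType X)) -> set_fixed_point_property K.

(* Main.v *)
(* Through its tail sums, X embeds isometrically into c_0 normed by
   x |-> sup x - inf x; this coordinate system is all that is used about X.
   By Zorn's lemma it suffices to treat a set K that is minimal among the
   nonempty weakly compact convex T-invariant sets; let d be its diameter.
   By the Goebel-Karlovitz lemma no approximate fixed point sequence of T stays
   in a ball of radius < d around a point of K, unless d = 0.
   Such a sequence is produced as follows (Dominguez Benavides). Let x_n be an
   approximate fixed point sequence with weak limit l along an ultrafilter, let
   z_n be the fixed point of z |-> (1 - e) T z + e (x_n + l) / 2, and let y be
   the weak limit of the z_n. The z_n are e d-almost fixed,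
   |z_n - z_m| <= d / 2, and |z_n - x_n| <= d / 2 + o(1), so |y - l| <= d / 2.
   In coordinates, |z_n - z_m| <= d / 2 forces the positive and the negative
   part of z_n - y to be eventually at most d / 4 each, hence
   |z_n - l| <= d / 2 + d / 4 + o(1), which is less than d.
   Weak closedness of norm closed convex sets (Mazur) and boundedness of weakly
   compact sets are derived from a Hahn-Banach theorem for convex functions. *)

Require Import Defs.
From HB Require Import structures.
From mathcomp Require Import all_boot all_order all_algebra.
From mathcomp Require Import all_classical all_reals all_analysis.
From mathcomp Require Import ring lra.
Import Order.TTheory GRing.Theory Num.Theory.
Import numFieldNormedType.Exports.

Set Implicit Arguments.
Unset Strict Implicit.
Unset Printing Implicit Defensive.

Local Open Scope classical_set_scope.
Local Open Scope ring_scope.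

(** * Hahn-Banach theorem *)

Section hahn_banach.
Variables (R : realType) (V : lmodType R).

Lemma scalar_pack (f : V -> R) :
  (forall a x y, f (a *: x + y) = a * f x + f y) ->
  exists g : {scalar V}, g =1 f.
Proof.
move=> lf.
pose g : {scalar V} := HB.pack f (GRing.isLinear.Build R V R *%R f lf).
by exists g.
Qed.

Variable p : V -> R.
Hypothesis convp : forall t x y, 0 <= t <= 1 ->
  p (t *: x + (1 - t) *: y) <= t * p x + (1 - t) * p y.
Hypothesis p0 : p 0 = 0.

(** Partial functionals are encoded as graphs, so that unions of chains stay in the class;
    single-valuedness is not part of the definition but follows from [p 0 = 0]. *)
Let dominated (G : set (V * R)) :=
  (forall a x r y s, G (x, r) -> G (y, s) -> G (a *: x + y, a * r + s)) /\
  (forall x r, G (x, r) -> r <= p x).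

Let dominated_fun G x r s : dominated G -> G (x, r) -> G (x, s) -> r = s.
Proof.
move=> [lG leG] Gr Gs; apply/eqP; rewrite -subr_eq0; apply/eqP.
have G0 : G (0, 0).
  by have := lG (-1) _ _ _ _ Gr Gr; rewrite scaleN1r mulN1r !addNr.
have Grs : G (0, r - s).
  by have := lG (-1) _ _ _ _ Gs Gr; rewrite scaleN1r mulN1r addNr addrC.
have h t : t * (r - s) <= 0.
  have := lG t _ _ _ _ Grs G0; rewrite scaler0 !addr0 => /leG.
  by rewrite p0.
by apply/eqP; rewrite eq_le; have := h 1; have := h (-1); lra.
Qed.

(** The value at [x0] must lie above all slopes taken in direction [- x0] and below all those in
    direction [x0]. By [key] these two families are ordered, and [c] is the supremum of the lower
    one. *)
Let dominated_extend G x0 : dominated G -> G (0, 0) ->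
  (forall r, ~ G (x0, r)) ->
  exists2 H, dominated H & G `<` H.
Proof.
move=> [lG leG] G0 nG.
have key x r s y r' t : G (x, r) -> G (y, r') -> 0 < s -> 0 < t ->
    (r - p (x - s *: x0)) / s <= (p (y + t *: x0) - r') / t.
  move=> Gx Gy s0 t0.
  have st0 : 0 < s + t by rewrite addr_gt0.
  rewrite ler_pdivrMr// mulrAC ler_pdivlMr//.
  (* With weights [t / (s + t)] and [s / (s + t)] the points [x - s *: x0] and [y + t *: x0] average
     to a point where the multiples of [x0] cancel, so convexity of [p] compares the two slopes. *)
  have := lG (t / (s + t)) _ _ _ _ Gx G0; rewrite !addr0 => Gx'.
  have /leG := lG (s / (s + t)) _ _ _ _ Gy Gx'.
  have e1 : 1 - t / (s + t) = s / (s + t).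
    by field; rewrite gt_eqF.
  have -> : (s / (s + t)) *: y + (t / (s + t)) *: x =
     t / (s + t) *: (x - s *: x0) + (1 - t / (s + t)) *: (y + t *: x0).
    rewrite e1 !scalerDr scalerN !scalerA addrACA.
    by rewrite [s / _ * t]mulrAC [t / _ * s]mulrAC [s * t]mulrC addNr addr0 addrC.
  have t01 : 0 <= t / (s + t) <= 1.
    apply/andP; split; first by rewrite divr_ge0// ltW.
    by rewrite ler_pdivrMr// mul1r lerDr ltW.
  move=> /le_trans/(_ (convp _ _ t01)); rewrite e1.
  rewrite ![_ / (s + t) * _]mulrAC -!mulrDl ler_pM2r ?invr_gt0//; lra.
pose lo := [set a | exists s x r, [/\ 0 < s, G (x, r) &
  a = (r - p (x - s *: x0)) / s]].
pose c := sup lo.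
have suplo : has_sup lo.
  split; first by exists ((0 - p (0 - 1 *: x0)) / 1), 1, 0, 0.
  by exists ((p (0 + 1 *: x0) - 0) / 1) => _ [s [x [r [s0 Gx ->]]]]; exact: key.
pose H := [set xr : V * R | exists t y r,
  [/\ G (y, r), xr.1 = y + t *: x0 & xr.2 = r + t * c]].
exists H; last first.
  split.
    by move=> [x r] Gx; exists 0, x, r; split=> //=; rewrite ?scale0r ?mul0r addr0.
  move=> HG; apply: (nG c); apply: HG; exists 1, 0, 0; split=> //=.
    by rewrite scale1r add0r.
  by rewrite mul1r add0r.
split=> [a x r y s [t [x' [r' [Gx /= -> ->]]]] [u [y' [s' [Gy /= -> ->]]]]|].
  exists (a * t + u), (a *: x' + y'), (a * r' + s'); split => /=.
  - exact: lG.
  - by rewrite scalerDr scalerDl scalerA addrACA.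
  - ring.
move=> _ _ [t [x [r [Gx /= -> ->]]]].
have [t0|t0|->] := ltgtP t 0; last by rewrite mul0r scale0r !addr0; exact: leG.
- have : (r - p (x - (- t) *: x0)) / (- t) <= c.
    by apply: sup_upper_bound => //; exists (- t), x, r; rewrite oppr_gt0.
  by rewrite ler_pdivrMr ?oppr_gt0// scaleNr opprK; lra.
- have : c <= (p (x + t *: x0) - r) / t.
    apply: ge_sup; first exact: suplo.1.
    by move=> _ [s [y [r' [s0 Gy ->]]]]; exact: key.
  by rewrite ler_pdivlMr//; lra.
Qed.

Lemma hahn_banach_convex : exists g : {scalar V}, forall x, g x <= p x.
Proof.
have [F Fdom totF|A [domA maxA]] := @Zorn_bigcup _ dominated.
  split=> [a x r y s [G FG Gx] [H FH Hy]|x r [G /Fdom[_ leG] /leG//]].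
  have [GH|HG] := totF _ _ FG FH.
  - by exists H => //; apply: (Fdom _ FH).1 => //; exact: GH.
  - by exists G => //; apply: (Fdom _ FG).1 => //; exact: HG.
(* The empty graph is dominated as well; maximality excludes it, since the graph reduced to the
   origin is larger. *)
have A0 : A (0, 0).
  apply: contrapT => nA; apply: (maxA [set (0, 0)]).
    split=> [[x r] Ax|/(_ (0, 0) erefl)//]; exfalso; apply: nA.
    by have := domA.1 (-1) _ _ _ _ Ax Ax; rewrite scaleN1r mulN1r !addNr.
  split=> [a x r y s [-> ->] [-> ->]|x r [-> ->]].
    by rewrite scaler0 mulr0 !addr0.
  by rewrite p0.
have totA x : exists r, A (x, r).
  apply: contrapT => /forallNP nA.
  have [H domH AH] := dominated_extend domA A0 nA.
  exact: (maxA H).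
have [f Af] := choice totA.
have [|g gf] := @scalar_pack f.
  move=> a x y; apply: (@dominated_fun A (a *: x + y)) => //.
  exact: domA.1.
by exists g => x; rewrite gf; exact: domA.2.
Qed.

End hahn_banach.

(** * Weak topology *)

Definition convex_in (R : realType) (V : lmodType R) (C : set V) :=
  forall t x y, 0 <= t <= 1 -> C x -> C y -> C (t *: x + (1 - t) *: y).

Lemma convex_set_convex_in (R : realType) (V : lmodType R) (C : set V) :
  convex_set (C : set (convex_lmodType V)) -> convex_in C.
Proof.
move=> cC t x y /andP[t0 t1] /mem_set Cx /mem_set Cy.
exact: set_mem (cC _ _ (Itv01 t0 t1) Cx Cy).
Qed.

Lemma convex_combination_id (R : pzRingType) (V : lmodType R) (t : R) (x : V) :
  t *: x + (1 - t) *: x = x.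
Proof. by rewrite -scalerDl addrC subrK scale1r. Qed.

Section functionals.
Variables (R : realType) (X : normedModType R).
Implicit Types (f : {scalar X}) (C : set X).

Lemma scalar_norm_le f (p : X -> R) :
  (forall x, f x <= p x) -> (forall x, p x <= `|x|) -> forall x, `|f x| <= `|x|.
Proof.
move=> fp px x; rewrite ler_norml lerNl -linearN.
by rewrite -{1}(normrN x) !(le_trans (fp _)).
Qed.

Lemma scalar_continuous f (M : R) :
  (forall x, `|f x| <= M * `|x|) -> continuous (f : X -> R).
Proof.
move=> fM x; apply/cvgrPdist_lt => e e0.
have M1 : 0 < `|M| + 1 by rewrite ltr_wpDl.
near=> y; rewrite -linearB (le_lt_trans (fM _))//.
apply: (@le_lt_trans _ _ ((`|M| + 1) * `|x - y|)).
  by rewrite ler_wpM2r// (le_trans (ler_norm _))// lerDl.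
rewrite mulrC -ltr_pdivlMr//.
near: y; apply: cvgr_dist_lt => //; by rewrite divr_gt0.
Unshelve. all: by end_near. Qed.

Lemma weak_continuous f : continuous (f : X -> R) ->
  continuous (f : weak_space X -> R).
Proof.
move=> cf x.
pose F := (exist _ f cf : topological_dual X).
have /(_ _ F) := fun FF => (@cvg_sup X (topological_dual X) (fun f : topological_dual X =>
    Topological.on (initial_topology (sval f : X -> R)))
    (nbhs (x : weak_space X)) x FF).1 (@cvg_id _ _).
move=> h A /(@initial_continuous _ _ (sval F : X -> R) x).
exact: h.
Qed.

Lemma weak_nbhs f (y : X) (e : R) : continuous (f : X -> R) -> 0 < e ->
  nbhs (y : weak_space X) [set x | `|f x - f y| < e].
Proof.
move=> /weak_continuous/(_ y) /cvgrPdist_lt/(_ e) + e0 => /(_ e0).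
by apply: filterS => x; rewrite distrC.
Qed.

(** The increment of the norm at [x] is convex, vanishes at 0 and is at most [|h|]. A functional
    below it is at most [- |x|] at [- x], hence norms [x]. *)
Lemma norming_functional (x : X) :
  exists2 f : {scalar X}, f x = `|x| & forall y, `|f y| <= `|y|.
Proof.
have [||g gp] := @hahn_banach_convex R X (fun h => `|x + h| - `|x|).
- move=> t y z /andP[t0 t1].
  have -> : x + (t *: y + (1 - t) *: z) = t *: (x + y) + (1 - t) *: (x + z).
    by rewrite !scalerDr [RHS]addrACA convex_combination_id.
  have := ler_normD (t *: (x + y)) ((1 - t) *: (x + z)).
  by rewrite !normrZ (ger0_norm t0) ger0_norm ?subr_ge0//; lra.
- by rewrite addr0 subrr.
have gle y : `|g y| <= `|y|.
  apply: scalar_norm_le gp _ y => z.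
  by rewrite lerBlDr addrC ler_normD.
exists g => //; apply/eqP; rewrite eq_le (le_trans (ler_norm _) (gle _))/=.
by have := gp (- x); rewrite subrr normr0 sub0r linearN lerN2.
Qed.

(* Separation: a functional dominated by h |-> d(y + h) - d(y), with d the
   distance to C, is at most - d(y) on C - y. *)
Lemma closed_convex_weakly_closed C : convex_in C -> closed C ->
  closed (C : set (weak_space X)).
Proof.
move=> convC clC y clCy; apply: contrapT => nCy.
have [c0 Cc0] : C !=set0.
  by have [c [Cc _]] := clCy setT (@filterT _ _ _); exists c.
pose D z := [set `|z - c| | c in C].
pose d z := inf (D z).
have hD z : has_inf (D z).
  by split; [exists `|z - c0|, c0|exists 0 => _ [c _ <-]].
have dle z c : C c -> d z <= `|z - c|.
  by move=> Cc; apply: ge_inf; [exact: (hD z).2|exists c].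
have dlt z e : 0 < e -> exists2 c, C c & `|z - c| < d z + e.
  by move=> e0; have [_ [c Cc <-] ?] := inf_adherent e0 (hD z); exists c.
have dy : 0 < d y.
  rewrite ltNge; apply/negP => dy0; apply: nCy; apply: clC => B.
  move=> /nbhs_ballP[e /= e0 Be]; have [c Cc yc] := dlt y _ e0.
  exists c; split=> //; apply: Be; rewrite -ball_normE /=.
  by apply: lt_le_trans yc _; rewrite gerDr.
have [||g gp] := @hahn_banach_convex R X (fun h => d (y + h) - d y).
- move=> t a b /andP[t0 t1].
  suff : d (y + (t *: a + (1 - t) *: b)) <=
      t * d (y + a) + (1 - t) * d (y + b) by lra.
  apply/ler_addgt0Pr => e e0.
  have [ca Cca ya] := dlt (y + a) _ e0.
  have [cb Ccb yb] := dlt (y + b) _ e0.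
  have Cab : C (t *: ca + (1 - t) *: cb) by apply: convC => //; exact/andP.
  apply: (le_trans (dle _ _ Cab)).
  have -> : y + (t *: a + (1 - t) *: b) - (t *: ca + (1 - t) *: cb) =
      t *: (y + a - ca) + (1 - t) *: (y + b - cb).
    rewrite !scalerBr [RHS]addrACA -opprD !scalerDr.
    by rewrite [t *: y + _ + _]addrACA convex_combination_id.
  apply: (le_trans (ler_normD _ _)).
  rewrite !normrZ (ger0_norm t0) ger0_norm ?subr_ge0//.
  have := ler_wpM2l t0 (ltW ya).
  have : (1 - t) * `|y + b - cb| <= (1 - t) * (d (y + b) + e).
    by rewrite ler_wpM2l ?subr_ge0// ltW.
  lra.
- by rewrite addr0 subrr.
have gle z : `|g z| <= `|z|.
  apply: scalar_norm_le gp _ z => z; rewrite lerBlDr.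
  apply/ler_addgt0Pr => e e0; have [c Cc yc] := dlt y _ e0.
  rewrite (le_trans (dle _ _ Cc))// (_ : y + z - c = z + (y - c)).
    by rewrite (le_trans (ler_normD _ _))// -addrA lerD// ltW.
  by rewrite addrAC addrC.
have cg : continuous (g : X -> R).
  by apply: (@scalar_continuous g 1) => z; rewrite mul1r.
(* Some [c] in [C] satisfies [g c - g y > - d y], while domination gives
   [g (c - y) <= d c - d y <= - d y]. *)
have [c [Cc]] := clCy _ (weak_nbhs y cg dy).
rewrite /= ltr_norml => /andP[gyc _].
have := gp (c - y); rewrite [y + _]addrC subrK linearB.
have := dle c c Cc; rewrite subrr normr0.
lra.
Qed.

End functionals.

(* One-dimensional Helly theorem. *)
Lemma common_point_intervals (R : realType) (I : Type) (a b : I -> R) :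
  (forall i k, `|a i - a k| <= b i + b k) ->
  exists l, forall i, `|l - a i| <= b i.
Proof.
move=> ab; have [[i0]|nI] := pselect (inhabited I); last first.
  by exists 0 => i; exfalso; apply: nI; constructor.
pose lo := [set a i - b i | i in [set: I]].
have lo_ub k : ubound lo (a k + b k).
  by move=> _ [i _ <-]; have := ab i k; rewrite ler_norml; lra.
have hs : has_sup lo by split; [exists (a i0 - b i0), i0|exists (a i0 + b i0)].
exists (sup lo) => i; rewrite ler_distl; apply/andP; split.
  by apply: sup_upper_bound => //; exists i.
by apply: ge_sup; [exact: hs.1|exact: lo_ub].
Qed.

(** * Weak limits along ultrafilters; closedness and boundedness of weakly compact sets *)

Section weak_compactness.
Variables (R : realType) (X : normedModType R).
Implicit Types (K C : set X) (z : nat -> X) (U : set_system nat).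

(** Ultrafilter limits play the role of weakly convergent subsequences: along an ultrafilter a
    cluster point is a limit. *)
Lemma weak_ultra_limit K U z : weakly_compact K -> UltraFilter U ->
  (forall n, K (z n)) ->
  exists2 y, K y & z n @[n --> U] --> (y : weak_space X).
Proof.
move=> cK UU Kz.
have [y [Ky cly]] := cK (fmap z U)
  (fmap_proper_filter z (@ultra_proper _ _ UU)) (@filterE _ U _ _ Kz).
exists y => // A yA.
have [//|UnA] := in_ultra_setVsetC (z @^-1` A) UU.
by have [x [nAx /nAx]] := cly (~` A) A UnA yA.
Qed.

Lemma weak_ultra_limit_functional U z (y : X) (f : {scalar X}) (e : R) :
  continuous (f : X -> R) -> z n @[n --> U] --> (y : weak_space X) -> 0 < e ->
  \forall n \near U, `|f (z n) - f y| < e.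
Proof. by move=> cf zy e0; exact: (zy _ (weak_nbhs y cf e0)). Qed.

Lemma weak_ultra_limit_closed_convex U z (y : X) C : UltraFilter U ->
  convex_in C -> closed C -> z n @[n --> U] --> (y : weak_space X) ->
  (\forall n \near U, C (z n)) -> C y.
Proof.
move=> UU vC /(closed_convex_weakly_closed vC) clC zy UC.
apply: clC => B /zy UB.
by have [n [Cn Bn]] := filter_ex (filterI UC UB); exists (z n).
Qed.

Lemma convex_closed_ball_ (c : X) (r : R) : convex_in (closed_ball_ Num.norm c r).
Proof.
move=> t x y /andP[t0 t1]; rewrite /closed_ball_ /= => cx cy.
rewrite -(convex_combination_id t c) opprD addrACA -!scalerBr.
rewrite (le_trans (ler_normD _ _))// !normrZ (ger0_norm t0).
rewrite ger0_norm ?subr_ge0//.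
have := ler_wpM2l t0 cx.
have : (1 - t) * `|c - y| <= (1 - t) * r by rewrite ler_wpM2l ?subr_ge0.
lra.
Qed.

Lemma weak_ultra_limit_ball U z (y c : X) (r : R) : UltraFilter U ->
  z n @[n --> U] --> (y : weak_space X) ->
  (\forall n \near U, `|c - z n| <= r) -> `|c - y| <= r.
Proof.
move=> UU zy.
have := weak_ultra_limit_closed_convex UU (@convex_closed_ball_ c r)
  (@closed_closed_ball_ _ _ c r) zy; exact.
Qed.

Lemma weakly_compact_closed K : weakly_compact K -> closed K.
Proof.
move=> cK p clp.
have h n : exists x, K x /\ `|p - x| < n.+1%:R^-1.
  have [|x [Kx px]] := clp (ball p n.+1%:R^-1); first exact: nbhsx_ballx.
  by exists x; split=> //; move: px; rewrite -ball_normE.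
have [z /all_and2[Kz pz]] := choice h.
have [U [UU ooU]] := ultraFilterLemma (_ : ProperFilter \oo).
have [y Ky zy] := weak_ultra_limit cK UU Kz.
suff -> : p = y by [].
apply/eqP; rewrite -subr_eq0 -normr_le0; apply/ler_addgt0Pr => e e0.
rewrite add0r; apply: weak_ultra_limit_ball zy _.
apply: ooU; near=> n; apply: ltW; apply: lt_trans (pz n) _.
by near: n; exact: near_infty_natSinv_lt (PosNum e0).
Unshelve. all: by end_near. Qed.

(* Sokal's gliding hump: with |y_n| > 2 n 3^n and phi_n norming y_n, the signs
   in f = sum_n +- 3^-n phi_n are chosen so that the n-th term does not cancel
   the previous ones at y_n, and the later terms only contribute half of it. *)
Lemma weakly_compact_bounded K : weakly_compact K ->
  exists M : R, forall x, K x -> `|x| <= M.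
Proof.
move=> cK; apply: contrapT => /forallNP nb.
have h n : exists x, K x /\ 2 * n%:R * 3 ^+ n < `|x|.
  apply: contrapT => /forallNP hn; apply: (nb (2 * n%:R * 3 ^+ n)) => x Kx.
  by rewrite leNgt; apply/negP => hx; exact: (hn x).
have [y /all_and2[Ky yn]] := choice h.
have hphi n : exists phi : {scalar X},
    phi (y n) = `|y n| /\ forall x, `|phi x| <= `|x|.
  by have [phi] := norming_functional (y n); exists phi.
have [phi /all_and2[phiy phile]] := choice hphi.
pose fix F n (x : X) {struct n} : R := if n is m.+1 then
  F m x + (-1) ^+ (F m (y m) < 0)%R * 3 ^- m * phi m x else 0.
(* The factor [3 / 2 * 3 ^- n] is the geometric tail, the sum of [3 ^- k] over [k >= n]. *)
pose b n (x : X) : R := 3 / 2 * 3 ^- n * `|x|.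
have three n : 0 < 3 ^- n :> R by rewrite invr_gt0 exprn_gt0.
have b_ge0 n x : 0 <= b n x.
  by rewrite /b !mulr_ge0// ltW.
have Fstep n x : `|F n.+1 x - F n x| <= 3 ^- n * `|x|.
  rewrite /= addrC addKr !normrM normrX normrN1 expr1n mul1r.
  by rewrite gtr0_norm// ler_pM2l.
have bS n x : b n.+1 x + 3 ^- n * `|x| = b n x.
  rewrite /b exprS invfM; field; exact: lt0r_neq0 (exprn_gt0 _ _).
have Fcauchy n k x : `|F (n + k)%N x - F n x| <= b n x.
  elim: k n => [|k IH] n; first by rewrite addn0 subrr normr0.
  rewrite -bS addnS -addSn (le_trans (ler_distD (F n.+1 x) _ _))// lerD//.
(* The sum of the series is taken as a common point of the intervals of radius [b n x] around the
   partial sums; linearity then holds up to multiples of [3 ^- n]. *)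
have Flim x : exists l, forall n, `|l - F n x| <= b n x.
  apply: common_point_intervals => n m.
  wlog nm : n m / (n <= m)%N.
    by move=> w; case: (leqP n m) => [/w//|/ltnW/w h']; rewrite distrC [leRHS]addrC.
  rewrite -(subnKC nm) distrC (le_trans (Fcauchy _ _ _))// lerDl//.
have [f0 Ff0] := choice Flim.
have Flin n a x v : F n (a *: x + v) = a * F n x + F n v.
  elim: n => [|n /= ->]; first by rewrite /= mulr0 addr0.
  rewrite linearP; ring.
have small (r M : R) : (forall n, `|r| <= 3 ^- n * M) -> r = 0.
  move=> rM; apply/eqP; rewrite -normr_le0; apply/ler_addgt0Pr => e e0.
  rewrite add0r.
  have M1 : 0 < `|M| + 1 by rewrite ltr_wpDl.
  have : (3^-1 : R) ^+ n @[n --> \oo] --> 0.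
    by apply: cvg_expr; rewrite ger0_norm// invf_lt1// ltr1n.
  move=> /cvgrPdist_lt/(_ (e / (`|M| + 1))); rewrite divr_gt0// => /(_ isT).
  move=> [n _ /(_ n (leqnn n))] /=; rewrite sub0r normrN exprVn gtr0_norm// => hn.
  apply: (le_trans (rM n)); apply: (@le_trans _ _ (3 ^- n * (`|M| + 1))).
    by rewrite ler_pM2l// (le_trans (ler_norm _))// lerDl.
  by rewrite -ler_pdivlMr// ltW.
have [|f ff0] := @scalar_pack R X f0.
  move=> a x v; apply/eqP; rewrite -subr_eq0; apply/eqP.
  apply: (small _ (3 / 2 * (`|a *: x + v| + `|a| * `|x| + `|v|))) => n.
  have -> : f0 (a *: x + v) - (a * f0 x + f0 v) =
      (f0 (a *: x + v) - F n (a *: x + v)) - a * (f0 x - F n x)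
      - (f0 v - F n v).
    by rewrite Flin; ring.
  rewrite (le_trans (ler_normB _ _))//.
  apply: (@le_trans _ _ (b n (a *: x + v) + `|a| * b n x + b n v)).
    rewrite lerD// (le_trans (ler_normB _ _))// lerD// normrM.
    by rewrite ler_wpM2l.
  by rewrite /b; lra.
have cf : continuous (f : X -> R).
  apply: (@scalar_continuous R X f (3 / 2)) => x; rewrite ff0.
  have := Ff0 x 0%N; rewrite /= subr0 /b expr0 invr1 mulr1//.
have fy n : n%:R < `|f (y n)|.
  (* The new term has the sign of [F n (y n)], so moduli add. The remaining tail [b n.+1 (y n)] is
     half of [3 ^- n * |y n|], which leaves more than [n]. *)
  have F1 : 3 ^- n * `|y n| <= `|F n.+1 (y n)|.
    rewrite /= phiy; case: ltP => /= s; have := three n; have := normr_ge0 (y n).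
      rewrite expr1 => y0 t0; rewrite ltr0_norm//; nra.
    rewrite expr0 mul1r => y0 t0; rewrite ger0_norm//; nra.
  have := Ff0 (y n) n.+1; rewrite -ff0; have := bS n (y n); rewrite {2}/b.
  have := ler_distD 0 (F n.+1 (y n)) (f (y n)).
  have : n%:R < 3 ^- n * `|y n| / 2.
    rewrite ltr_pdivlMr// [ltRHS]mulrC ltr_pdivlMr ?exprn_gt0//.
    by rewrite [_ * 2]mulrC.
  rewrite distrC; have := ler_normB (f (y n)) (f (y n) - F n.+1 (y n)).
  by rewrite subKr; lra.
(* Along [U] the values [f (y n)] stay within 1 of [f l], although they exceed [n] in modulus. *)
have [U [UU ooU]] := ultraFilterLemma (_ : ProperFilter \oo).
have [l Kl yl] := weak_ultra_limit cK UU Ky.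
have Ul := weak_ultra_limit_functional cf yl (@ltr01 R).
have Un : \forall n \near U, `|f l| + 1 <= n%:R.
  by apply: ooU; exact: nbhs_infty_ger.
have [n [/= ln lfn]] := filter_ex (filterI Ul Un).
have := fy n; have := ler_normD (f (y n) - f l) (f l); rewrite subrK; lra.
Qed.

End weak_compactness.

(** * Minimal invariant sets *)

Section minimal_invariant_sets.
Variables (R : realType) (X : completeNormedModType R).
Implicit Types (T : X -> X) (K C : set X).

Lemma nonexpansive_resolvent K T x0 (e : R) : closed K -> convex_in K ->
  (forall x, K x -> K (T x)) -> nonexpansive_on K T -> K x0 -> 0 < e <= 1 ->
  exists2 z, K z & z = (1 - e) *: T z + e *: x0.
Proof.
move=> clK cK TK nT Kx0 /andP[e0 e1].
pose g x := (1 - e) *: T x + e *: x0.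
have gK : {homo g : x / K x >-> K x}.
  move=> x Kx; have := cK (1 - e) (T x) x0 _ (TK _ Kx) Kx0.
  by rewrite subKr; apply; rewrite subr_ge0 e1/= gerBl ltW.
have q0 : 0 <= 1 - e by rewrite subr_ge0.
have ctr : is_contraction (mkfun gK).
  exists (NngNum q0); split => /=; first by rewrite gtrBl.
  move=> [x y] [/= Kx Ky]; rewrite /g /mkfun/= opprD addrACA subrr addr0.
  by rewrite -scalerBr normrZ ger0_norm// ler_wpM2l// nT.
have [|z Kz gz] := banach_fixed_point ctr clK; first by exists x0.
by exists z.
Qed.

Definition invariant_closed_convex T C :=
  [/\ C !=set0, closed C, convex_in C & forall x, C x -> C (T x)].

(** Zorn's lemma is applied to the removed part [A], so that unions of chains become intersections
    of the sets [K \ A]. These are weakly closed by convexity, and weak compactness keeps the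
    intersection nonempty. *)
Lemma minimal_invariant_closed_convex T K :
  weakly_compact K -> invariant_closed_convex T K ->
  exists K0, [/\ weakly_compact K0, invariant_closed_convex T K0, K0 `<=` K &
    forall C, C `<=` K0 -> invariant_closed_convex T C -> K0 `<=` C].
Proof.
move=> cK iK.
pose P A := invariant_closed_convex T (K `\` A).
have [F FP totF|A [PA maxA]] := @Zorn_bigcup _ P.
  have [[A0 FA0]|F0] := pselect (F !=set0); last first.
    rewrite (_ : \bigcup_(A in F) A = set0) /P ?setD0//.
    by rewrite -subset0 => x [A FA _]; apply: F0; exists A.
  have KF : K `\` \bigcup_(A in F) A = \bigcap_(A in F) (K `\` A).
    apply/seteqP; split=> [x [Kx nx] A FA|x hx].
      by split=> // Ax; apply: nx; exists A.
    by split=> [|[A FA Ax]]; [exact: (hx _ FA0).1|exact: (hx _ FA).2].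
  rewrite /P KF; split.
  - have FF : ProperFilter (filter_from F (fun A => K `\` A)).
      apply: filter_from_proper; last by move=> A /FP[].
      apply: filter_from_filter; first by exists A0.
      move=> A B FA FB; have [AB|BA] := totF _ _ FA FB.
        by exists B => // x [Kx nB]; split; split=> // /AB.
      by exists A => // x [Kx nA]; split; split=> // /BA.
    have [|x [Kx clx]] := cK _ FF; first by exists A0 => // x [].
    exists x => A FA.
    have [_ clA cA _] := FP _ FA.
    apply: (closed_convex_weakly_closed cA clA) => B xB.
    by apply: clx xB; exists A.
  - by apply: closed_bigI => A /FP[].
  - move=> t x y t01 hx hy A FA; have [_ _ cA _] := FP _ FA.
    by apply: cA => //; [exact: hx|exact: hy].
  - by move=> x hx A FA; have [_ _ _ TA] := FP _ FA; apply: TA; exact: hx.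
exists (K `\` A); split=> //.
- have [_ clA cA _] := PA.
  apply: (@subclosed_compact (weak_space X)) cK _; last by move=> x [].
  exact: (closed_convex_weakly_closed cA clA).
- move=> C CKA iC x KAx; apply: contrapT => nCx.
  apply: (maxA (A `|` ~` C)).
    split=> [y Ay|BA]; first by left.
    by apply: KAx.2; apply: BA; right.
  rewrite /P (_ : K `\` _ = C)//; apply/seteqP; split=> [y [Ky nACy]|y Cy].
    by apply: contrapT => nCy; apply: nACy; right.
  by have [Ky nAy] := CKA y Cy; split=> // -[].
Qed.

(** * Diametrality of minimal sets *)

Section diametral.
Variables (T : X -> X) (K : set X).
Hypothesis cK : weakly_compact K.
Hypothesis iK : invariant_closed_convex T K.
Hypothesis minK :
  forall C, C `<=` K -> invariant_closed_convex T C -> K `<=` C.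
Hypothesis nT : nonexpansive_on K T.

(** The points of [K] within [r] of all of [K] form an invariant closed convex set containing [z],
    so by minimality they fill [K]. *)
Lemma minimal_diametral z (r : R) : K z -> (forall y, K y -> `|z - y| <= r) ->
  forall x y, K x -> K y -> `|x - y| <= r.
Proof.
move=> Kz zr; have [_ clK vK TK] := iK.
pose C := K `&` \bigcap_(y in K) closed_ball_ Num.norm y r.
suff KC : K `<=` C by move=> x y Kx /KC[_ /(_ _ Kx)].
apply: minK => [x []//|]; split.
- by exists z; split=> // y Ky; rewrite /closed_ball_/= distrC zr.
- by apply: closedI => //; apply: closed_bigI => y _; exact: closed_closed_ball_.
- move=> t x y t01 [Kx Cx] [Ky Cy]; split; first exact: vK.
  by move=> w Kw; apply: convex_closed_ball_ => //; [exact: Cx|exact: Cy].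
- move=> x [Kx Cx]; split; first exact: TK.
  (* A second use of minimality: since [x] is within [r] of all of [K], [T] maps [K] into the ball
     around [T x], so the part of [K] in that ball is invariant. *)
  suff KB : K `<=` K `&` closed_ball_ Num.norm (T x) r.
    by move=> y /KB[_]; rewrite /closed_ball_/= distrC.
  apply: minK => [y []//|]; split.
  + exists (T x); split; first exact: TK.
    by rewrite /closed_ball_/= subrr normr0 (le_trans _ (zr _ Kz)).
  + by apply: closedI => //; exact: closed_closed_ball_.
  + move=> t y w t01 [Ky By] [Kw Bw]; split; first exact: vK.
    exact: convex_closed_ball_.
  + move=> y [Ky _]; split; first exact: TK.
    rewrite /closed_ball_/= (le_trans (nT _ _))// distrC; exact: Cx.
Qed.

(* The Goebel--Karlovitz lemma. *)
Lemma minimal_approximate_fixed_points (q : nat -> X) x (r : R) :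
  (forall n, K (q n)) -> T (q n) - q n @[n --> \oo] --> 0 ->
  K x -> (forall n, `|q n - x| <= r) ->
  forall a b, K a -> K b -> `|a - b| <= r.
Proof.
move=> Kq Tq Kx qx; have [_ clK vK TK] := iK.
(* These are the points whose asymptotic distance, the upper limit of [|q n - y|], is at most [r];
   [T] preserves it because the [q n] are almost fixed. *)
pose C := [set y | K y /\ forall e, 0 < e -> \forall n \near \oo, `|q n - y| <= r + e].
have KC : K `<=` C.
  apply: minK => [y []//|]; split.
  - by exists x; split=> // e e0; apply: nearW => n; rewrite (le_trans (qx n))// lerDl ltW.
  - move=> y Cy; split; first by apply: clK => B /Cy[w [[Kw _] Bw]]; exists w.
    move=> e e0; have e20 : 0 < e / 2 by rewrite divr_gt0.
    have [w [[Kw /(_ _ e20)Cw]]] := Cy _ (nbhsx_ballx y _ e20).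
    rewrite -ball_normE/= distrC => yw.
    apply: filterS Cw => n qw; rewrite (le_trans (ler_distD w _ _))//.
    by rewrite [e]splitr addrA lerD// ltW.
  - move=> t y w t01 [Ky Cy] [Kw Cw]; split; first exact: vK.
    move=> e e0; apply: filterS2 (Cy _ e0) (Cw _ e0) => n.
    exact: convex_closed_ball_.
  - move=> y [Ky Cy]; split; first exact: TK.
    move=> e e0; have e20 : 0 < e / 2 by rewrite divr_gt0.
    move/cvgrPdist_le: Tq => /(_ _ e20) Tq.
    apply: filterS2 (Cy _ e20) Tq => n; rewrite sub0r normrN => yn qn.
    rewrite (le_trans (ler_distD (T (q n)) _ _))// distrC.
    rewrite [e]splitr [r + _]addrCA lerD// (le_trans _ yn)//.
    exact: nT.
(* Now every point of [K] is asymptotically within [r] of the [q n], hence within [r] of their weak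
   limit [z]. *)
have [U [UU ooU]] := ultraFilterLemma (_ : ProperFilter \oo).
have [z Kz qz] := weak_ultra_limit cK UU Kq.
apply: (minimal_diametral Kz) => y Ky; apply/ler_addgt0Pr => e e0.
rewrite distrC; apply: weak_ultra_limit_ball qz _.
by have [_ /(_ _ e0)/ooU] := KC _ Ky; apply: filterS => n; rewrite distrC.
Qed.

End diametral.

End minimal_invariant_sets.

(** * Oscillation coordinates *)

(* A norm-preserving embedding of X into c_0 normed by x |-> sup x - inf x. *)
Record oscillation_coordinates (R : realType) (X : normedModType R)
    (u : nat -> X -> R) : Prop := OscillationCoordinates {
  coord_linear : forall i a x y, u i (a *: x + y) = a * u i x + u i y;
  coord_norm : forall i x, `|u i x| <= `|x|;
  coord_osc_le : forall i k x, u i x - u k x <= `|x|;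
  coord_norm_le : forall x r, (forall i k, u i x - u k x <= r) -> `|x| <= r;
  coord_cvg0 : forall x, u i x @[i --> \oo] --> (0 : R) }.

Lemma coordB (R : realType) (X : normedModType R) (u : nat -> X -> R) i x y :
  oscillation_coordinates u -> u i (x - y) = u i x - u i y.
Proof.
by case=> ul _ _ _ _; have := ul i (-1) y x; rewrite scaleN1r addrC => ->; lra.
Qed.

Lemma coordN (R : realType) (X : normedModType R) (u : nat -> X -> R) i x :
  oscillation_coordinates u -> u i (- x) = - u i x.
Proof.
move=> uP; rewrite -sub0r (coordB _ _ _ uP) -[X in u i X](subrr x).
by rewrite (coordB _ _ _ uP) subrr sub0r.
Qed.

(* Otherwise w_n has a large coordinate i; for U-most m, w_m has a large
   coordinate k as well, and k lies far beyond i, where w_n is small. Then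
   (w_n - w_m)_i - (w_n - w_m)_k exceeds 2 c. *)
Lemma separated_tail_le (R : realType) (X : normedModType R) (u : nat -> X -> R)
    (U : set_system nat) (w : nat -> X) (w0 : X) (c e : R) :
  oscillation_coordinates u -> UltraFilter U -> 0 <= c ->
  (forall n m, `|w n - w m| <= 2 * c) ->
  (forall i (d : R), 0 < d -> \forall n \near U, `|u i (w n) - u i w0| < d) ->
  0 < e ->
  exists N, \forall n \near U, forall i, (N <= i)%N -> u i (w n) <= c + e.
Proof.
move=> uP UU c0 wc w_cvg e0; have e2 : 0 < e / 2 by rewrite divr_gt0.
have small x : exists N, forall i, (N <= i)%N -> `|u i x| <= e / 2.
  have /cvgrPdist_le/(_ _ e2)[N _ hN] := coord_cvg0 uP x.
  by exists N => i Ni; have := hN i Ni; rewrite /= sub0r normrN.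
have [N hN] := small w0; exists N.
pose A := [set n | forall i, (N <= i)%N -> u i (w n) <= c + e].
have [//|UnA] := in_ultra_setVsetC A UU; exfalso.
have [n /existsNP[i /not_implyP[Ni nwi]]] := filter_ex UnA.
have wni : c + e < u i (w n) by rewrite ltNge; exact/negP.
have [M hM] := small (w n).
have UM : \forall m \near U, forall k : 'I_M, `|u k (w m) - u k w0| < e / 2.
  by apply: filter_forall => k; exact: w_cvg.
have [m [/existsNP[k /not_implyP[Nk nwk]] [Mm im]]] :=
  filter_ex (filterI UnA (filterI UM (w_cvg i _ e2))).
have wmk : c + e < u k (w m) by rewrite ltNge; exact/negP.
(* If [k < M], then [w m] is close to [w0] at [k], and [w0] is small there because [N <= k]; this
   contradicts [wmk]. *)
have [kM|Mk] := ltnP k M.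
  have wm : u k (w m) - u k w0 < e / 2.
    exact: le_lt_trans (ler_norm _) (Mm (Ordinal kM)).
  have w0k : u k w0 <= e / 2 := le_trans (ler_norm _) (hN k Nk).
  lra.
have wnk : u k (w n) <= e / 2 := le_trans (ler_norm _) (hM k Mk).
have w0i : u i w0 <= e / 2 := le_trans (ler_norm _) (hN i Ni).
have wmi : u i (w m) - u i w0 < e / 2 := le_lt_trans (ler_norm _) im.
have wnm : u i (w n - w m) - u k (w n - w m) <= 2 * c.
  exact: le_trans (coord_osc_le uP _ _ _) (wc _ _).
rewrite !(coordB _ _ _ uP) in wnm; lra.
Qed.

(** The tail bound for [w] and [- w] confines late coordinates to [c + e / 2] in modulus, and the
    finitely many others are within [e / 2] of those of [w0]. Two coordinates of the same kind
    differ by at most [2 * c + e]. The mixed case costs [2 * c] from [w0] and [c] from the tail. *)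
Lemma separated_norm_le (R : realType) (X : normedModType R) (u : nat -> X -> R)
    (U : set_system nat) (w : nat -> X) (w0 : X) (c e : R) :
  oscillation_coordinates u -> UltraFilter U -> 0 <= c ->
  (forall n m, `|w n - w m| <= 2 * c) ->
  (forall i (d : R), 0 < d -> \forall n \near U, `|u i (w n) - u i w0| < d) ->
  `|w0| <= 2 * c -> 0 < e -> \forall n \near U, `|w n| <= 3 * c + e.
Proof.
move=> uP UU c0 wc w_cvg w0c e0; have e2 : 0 < e / 2 by rewrite divr_gt0.
have [N1 h1] := separated_tail_le uP UU c0 wc w_cvg e2.
have [||N2 h2] := @separated_tail_le R X u U (fun n => - w n) (- w0) c _ uP UU c0 _ _ e2.
- by move=> n m; rewrite -opprD normrN.
- move=> i d d0; apply: filterS (w_cvg i d d0) => n.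
  by rewrite !(coordN _ _ uP) -opprD normrN.
pose N := maxn N1 N2.
have UN : \forall n \near U, forall k : 'I_N, `|u k (w n) - u k w0| < e / 2.
  by apply: filter_forall => k; exact: w_cvg.
apply: filterS3 h1 h2 UN => n h1 h2 hN; apply: (coord_norm_le uP) => i k.
have w0i := le_trans (coord_norm uP i w0) w0c.
have w0k := le_trans (coord_norm uP k w0) w0c.
have w0ik := le_trans (coord_osc_le uP i k w0) w0c.
move: w0i w0k; rewrite !ler_norml => /andP[w0i1 w0i2] /andP[w0k1 w0k2].
have near_w0 j : (j < N)%N -> u j w0 - e / 2 < u j (w n) < u j w0 + e / 2.
  by move=> jN; rewrite -ltr_distl; exact: (hN (Ordinal jN)).
have tail j : (N <= j)%N -> - (c + e / 2) <= u j (w n) <= c + e / 2.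
  rewrite geq_max => /andP[/h1 -> /h2]; rewrite (coordN _ _ uP) andbT; lra.
have [/near_w0/andP[wi1 wi2]|/tail/andP[wi1 wi2]] := ltnP i N;
  have [/near_w0/andP[wk1 wk2]|/tail/andP[wk1 wk2]] := ltnP k N; lra.
Qed.

(** * The fixed point argument in coordinates *)

Lemma coordinates_fixed_point_property (R : realType)
    (X : completeNormedModType R) (u : nat -> X -> R) :
  oscillation_coordinates u -> fixed_point_property X.
Proof.
move=> uP K K0 cK vK T nT.
have [|K1 [cK1 iK1 K1K minK1]] := @minimal_invariant_closed_convex R X T K cK.
  split=> //; first exact: weakly_compact_closed.
  - exact: convex_set_convex_in.
  - by move=> x Kx; exact: funS.
have nT1 : nonexpansive_on K1 T by move=> x y /K1K Kx /K1K; exact: nT.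
have [[a K1a] clK1 vK1 TK1] := iK1.
pose D := [set `|xy.1 - xy.2| | xy in K1 `*` K1].
have hD : has_sup D.
  split; first by exists `|a - a|, (a, a).
  have [M hM] := weakly_compact_bounded cK1.
  exists (M + M) => _ [[x y] [/= Kx Ky] <-].
  by rewrite (le_trans (ler_normB _ _))// lerD// hM.
pose d := sup D.
have dP x y : K1 x -> K1 y -> `|x - y| <= d.
  by move=> Kx Ky; apply: sup_upper_bound => //; exists (x, y).
have [d0|d0] := lerP d 0.
  exists a; first exact: K1K.
  apply/eqP; rewrite -subr_eq0 -normr_le0; apply: le_trans (dP _ _ _ _) d0 => //.
  exact: TK1.
exfalso.
(* Here [7 / 8] is [3 / 4 + 1 / 8], from [separated_norm_le] with [c = d / 4] and slack [d / 8]; any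
   slack below [d / 4] would do. *)
suff : d <= 7 / 8 * d by lra.
have residual z m (e : R) : K1 z -> K1 m -> 0 <= e -> z = (1 - e) *: T z + e *: m ->
    `|T z - z| <= e * d.
  move=> Kz Km e0 zE; rewrite [X in _ - X]zE.
  have -> : T z - ((1 - e) *: T z + e *: m) = e *: (T z - m).
    rewrite -{1}(convex_combination_id e (T z)) opprD addrA.
    by rewrite addrK -scalerBr.
  by rewrite normrZ ger0_norm// ler_wpM2l// dP//; exact: TK1.
have inv01 n : 0 < (n.+1%:R^-1 : R) <= 1.
  by rewrite invr_gt0 ltr0n/= invf_le1// ler1n.
have /choice[x hx] : forall n, exists x, K1 x /\ `|T x - x| <= n.+1%:R^-1 * d.
  move=> n; have [z Kz zE] := nonexpansive_resolvent clK1 vK1 TK1 nT1 K1a (inv01 n).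
  exists z; split=> //; apply: (residual _ _ _ Kz K1a _ zE).
  by case/andP: (inv01 n) => /ltW.
have [K1x Tx] := all_and2 hx.
have [U [UU ooU]] := ultraFilterLemma (_ : ProperFilter \oo).
have [l K1l xl] := weak_ultra_limit cK1 UU K1x.
have key (e : R) : 0 < e <= 1 ->
    exists q, [/\ K1 q, `|T q - q| <= e * d & `|q - l| <= 7 / 8 * d].
  move=> /[dup] e01 /andP[e0 e1].
  have e_ge0 := ltW e0; have e1_ge0 : 0 <= 1 - e by rewrite subr_ge0.
  have half01 : 0 <= (2^-1 : R) <= 1 by apply/andP; split; lra.
  pose m n := 2^-1 *: x n + (1 - 2^-1) *: l.
  have K1m n : K1 (m n) by exact: vK1.
  have /choice[z hz] : forall n, exists z, K1 z /\ z = (1 - e) *: T z + e *: m n.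
    move=> n; have [z Kz zE] := nonexpansive_resolvent clK1 vK1 TK1 nT1 (K1m n) e01.
    by exists z.
  have [K1z zE] := all_and2 hz.
  have [y K1y zy] := weak_ultra_limit cK1 UU K1z.
  (* The distance is at most [1 - e] times itself plus [e] times [|m n - m k|], and the midpoints
     [m n], [m k] share the half coming from [l]. *)
  have zz n k : `|z n - z k| <= 2^-1 * d.
    have : `|z n - z k| <= (1 - e) * `|z n - z k| + e * (2^-1 * d).
      rewrite {1}zE {1}[z k]zE opprD addrACA -!scalerBr.
      rewrite (le_trans (ler_normD _ _))// !normrZ (ger0_norm e1_ge0) (ger0_norm e_ge0).
      rewrite lerD ?ler_wpM2l ?nT1//.
      rewrite /m opprD addrACA subrr addr0 -scalerBr normrZ ger0_norm; last lra.
      by rewrite ler_wpM2l ?dP//; lra.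
    by move=> h; rewrite -(ler_pM2l e0); lra.
  (* Here [x n] is compared with [(1 - e) *: T (x n) + e *: x n]. Solving for the distance divides
     the defect of [x n] by [e], which is harmless as [e] is fixed while [n] grows. *)
  have zx n : `|z n - x n| <= 2^-1 * d + e^-1 * (n.+1%:R^-1 * d).
    have : `|z n - x n| <= (1 - e) * (`|z n - x n| + n.+1%:R^-1 * d)
        + e * (2^-1 * d).
      rewrite {1}zE -{1}(convex_combination_id e (x n)) [e *: x n + _]addrC.
      rewrite opprD addrACA -!scalerBr.
      rewrite (le_trans (ler_normD _ _))// !normrZ (ger0_norm e1_ge0) (ger0_norm e_ge0).
      rewrite lerD ?ler_wpM2l//.
        rewrite (le_trans (ler_distD (T (x n)) _ _))// lerD//.
        exact: nT1.
      rewrite /m -{2}(convex_combination_id 2^-1 (x n)) opprD addrACA subrr add0r.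
      rewrite -scalerBr normrZ ger0_norm; last lra.
      by rewrite (_ : 1 - 2^-1 = 2^-1); [rewrite ler_wpM2l ?dP//; lra|lra].
    move=> h; rewrite -(ler_pM2l e0) mulrDr mulVKf ?gt_eqF//.
    have : 0 <= e * (n.+1%:R^-1 * d).
      by rewrite !mulr_ge0 ?invr_ge0// ltW.
    move: (n.+1%:R^-1 * d) h => b; lra.
  (* Both [z n] and [x n] vary, so the bound [zx] is passed to the weak limits through a functional
     norming [y - l]. *)
  have yl : `|y - l| <= 2 * (d / 4).
    have [f fyl fle] := norming_functional (y - l).
    have cf : continuous (f : X -> R).
      by apply: (@scalar_continuous R X f 1) => v; rewrite mul1r.
    rewrite (_ : 2 * (d / 4) = 2^-1 * d); last lra.
    apply/ler_addgt0Pr => b b0; have b3 : 0 < b / 3 by rewrite divr_gt0.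
    have Uz := weak_ultra_limit_functional cf zy b3.
    have Ux := weak_ultra_limit_functional cf xl b3.
    have Ub : \forall n \near U, e^-1 * (n.+1%:R^-1 * d) < b / 3.
      apply: ooU; have b' : 0 < b / 3 * e / d by rewrite !mulr_gt0 ?invr_gt0.
      apply: filterS (near_infty_natSinv_lt (PosNum b')) => n /=.
      by rewrite ltr_pdivlMr// -ltr_pdivrMr// mulrC.
    have [n [nz [nx nb]]] := filter_ex (filterI Uz (filterI Ux Ub)).
    have h1 : f (z n) - f (x n) <= `|z n - x n|.
      by rewrite -linearB (le_trans (ler_norm _)).
    have h2 : - (b / 3) < f (z n) - f y by move: nz; rewrite ltr_norml => /andP[].
    have h3 : f (x n) - f l < b / 3 by move: nx; rewrite ltr_norml => /andP[].
    have h4 : `|z n - x n| <= 2^-1 * d + b / 3.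
      by rewrite (le_trans (zx n))// lerD2l ltW.
    rewrite -fyl linearB; move: h1 h2 h3 h4.
    move: (f (z n) : R) (f (x n) : R) (f y : R) (f l : R) `|_| => fz fx fy fl r.
    lra.
  have Un : \forall n \near U, `|z n - l| <= 3 * (d / 4) + d / 8.
    apply: (@separated_norm_le R X u U (fun n => z n - l) (y - l)) => //.
    - by rewrite divr_ge0// ltW.
    - move=> n k; rewrite opprB addrA subrK (le_trans (zz n k))//; lra.
    - move=> i b b0; have [f fu] := scalar_pack (coord_linear uP i).
      have cf : continuous (f : X -> R).
        apply: (@scalar_continuous R X f 1) => v; rewrite mul1r fu.
        exact: coord_norm.
      apply: filterS (weak_ultra_limit_functional cf zy b0) => n.
      by rewrite !fu !(coordB _ _ _ uP) opprB addrA subrK.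
    - by rewrite divr_gt0.
  have [n zl] := filter_ex Un; exists (z n); split=> //.
    exact: (residual _ _ _ (K1z n) (K1m n) (ltW e0) (zE n)).
  by apply: le_trans zl _; lra.
(* The centre [l] was fixed before [e], so letting [e] run through [n.+1%:R^-1] gives one
   approximate fixed point sequence in a single ball. *)
have [q hq] := choice (fun n => key _ (inv01 n)).
have K1q n : K1 (q n) by case: (hq n).
have Tq : T (q n) - q n @[n --> \oo] --> 0.
  apply/cvgrPdist_lt => b b0; have b' : 0 < b / d by rewrite divr_gt0.
  apply: filterS (near_infty_natSinv_lt (PosNum b')) => n /=.
  rewrite ltr_pdivlMr// sub0r normrN; apply: le_lt_trans.
  by case: (hq n).
apply: ge_sup; first exact: hD.1.
move=> _ [[v w] [/= Kv Kw] <-].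
apply: (minimal_approximate_fixed_points cK1 iK1 minK1 nT1 K1q Tq K1l _ Kv Kw).
by move=> n; case: (hq n).
Qed.

(** * Coordinates on the completion of c00 *)

Section completion.
Variables (R : realType) (V : normedModType R) (X : completeNormedModType R).
Variable j : {linear V -> X}.
Hypothesis jP : is_completion j.

Lemma completion_approx (x : X) (e : R) : 0 < e -> exists v, `|x - j v| < e.
Proof.
move=> e0; have [||y [xy [v _ vy]]] := jP.2 (ball x e).
- by exists x; exact: ballxx.
- exact: ball_open.
by exists v; move: xy; rewrite -ball_normE -vy.
Qed.

(** The value at [x] is a common point of the intervals of radius [|x - j v|] around [g v], which
    meet pairwise because [g] is 1-Lipschitz. Taking [x = j v] shows that [G] extends [g]. *)
Lemma completion_extend (g : V -> R) :
  (forall a v w, g (a *: v + w) = a * g v + g w) ->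
  (forall v, `|g v| <= `|v|) ->
  exists G : X -> R,
    (forall a x y, G (a *: x + y) = a * G x + G y) /\
    (forall x v, `|G x - g v| <= `|x - j v|).
Proof.
move=> gl gle.
have gB v w : g v - g w = g (v - w).
  by have := gl (-1) w v; rewrite scaleN1r addrC => ->; lra.
have /choice[G hG] : forall x, exists l, forall v, `|l - g v| <= `|x - j v|.
  move=> x; apply: (@common_point_intervals R V) => v w.
  rewrite gB (le_trans (gle _))// -jP.1 linearB distrC.
  by rewrite (le_trans (ler_distD x _ _))// addrC distrC lerD// distrC.
exists G; split=> // a x y.
apply/eqP; rewrite -subr_eq0 -normr_le0; apply/ler_addgt0Pr => e e0.
have a1 : 0 < `|a| + 1 by rewrite ltr_wpDl.
have d0 : 0 < e / 4 / (`|a| + 1) by rewrite !divr_gt0.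
have d4 : 0 < e / 4 by rewrite divr_gt0.
have [v xv] := completion_approx x d0.
have [w yw] := completion_approx y d4.
have axv : `|a| * `|x - j v| <= e / 4.
  rewrite (@le_trans _ _ ((`|a| + 1) * `|x - j v|))//.
    by rewrite ler_wpM2r// lerDl.
  by rewrite mulrC -ler_pdivlMr// ltW.
have -> : G (a *: x + y) - (a * G x + G y) =
    (G (a *: x + y) - g (a *: v + w)) - a * (G x - g v) - (G y - g w).
  by rewrite gl; ring.
have h1 : `|G (a *: x + y) - g (a *: v + w)| <= `|a| * `|x - j v| + `|y - j w|.
  rewrite (le_trans (hG _ _))// linearP opprD addrACA -scalerBr.
  by rewrite (le_trans (ler_normD _ _))// normrZ.
have h2 : `|a * (G x - g v)| <= `|a| * `|x - j v|.
  by rewrite normrM ler_wpM2l.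
have h3 := hG y w.
rewrite add0r (le_trans (ler_normB _ _))//.
have h4 := ler_normB (G (a *: x + y) - g (a *: v + w)) (a * (G x - g v)).
lra.
Qed.

End completion.

(** * Tail sums of finitely supported sequences *)

Section tails.
Variable R : realType.

(** [g i v] is the sum of [v] from [i] on, cut at a bound [N v] of the support. Interval sums are
    differences of tails, which turns the interval norm into an oscillation. *)
Lemma c00_tails : exists (N : c00 R -> nat) (g : nat -> c00 R -> R),
  [/\ forall i a v w, g i (a *: v + w) = a * g i v + g i w,
      forall m n v, (m <= n)%N -> g m v - g n v = \sum_(m <= i < n) val v i,
      forall i v, `|g i v| <= `|v| &
      forall i v, (N v <= i)%N -> g i v = 0].
Proof.
have /choice[N NP] : forall v : c00 R, exists N, forall i, (N <= i)%N -> val v i = 0.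
  move=> v; have : finite_set [set i | val v i != 0] by have := valP v; rewrite inE.
  move=> /finite_seqP[A /seteqP[sA _]].
  exists (\max_(i <- A) i).+1 => i Ai; apply/eqP; apply: contraTT Ai => /sA iA.
  by rewrite -leqNgt (@leq_bigmax_seq _ _ xpredT id).
pose g i v := \sum_(i <= k < N v) val v k.
have gM i v M : (N v <= M)%N -> g i v = \sum_(i <= k < M) val v k.
  move=> NM; have [iN|Ni] := leqP i (N v).
    rewrite [RHS](big_cat_nat (n := N v))//= [X in _ + X]big_nat_cond.
    by rewrite [X in _ + X]big1 ?addr0// => k /andP[/andP[/NP]].
  rewrite /g big_geq 1?ltnW// big_nat_cond big1// => k /andP[/andP[ik _] _].
  by apply: NP; rewrite (leq_trans (ltnW Ni)).
exists N, g; split=> [i a v w|m n v mn|i v|i v Nvi].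
- pose M := maxn (N (a *: v + w)) (maxn (N v) (N w)).
  rewrite !(gM _ _ M) /M ?leq_max ?leqnn ?orbT//.
  by rewrite mulr_sumr -big_split.
- pose M := maxn (N v) n.
  rewrite !(gM _ _ M) /M ?leq_maxl//.
  by rewrite (big_cat_nat (n := n)) ?leq_maxr//= addrK.
- exact: interval_norm_ub.
- by rewrite /g big_geq.
Qed.

End tails.

(** The coordinates extend the tail sums; each property holds on [c00] and passes to [x] by
    approximation, all coordinates moving by at most [|x - j v|]. *)
Lemma completion_coordinates (R : realType) (X : completeNormedModType R)
    (j : {linear c00 R -> X}) :
  is_completion j -> exists u : nat -> X -> R, oscillation_coordinates u.
Proof.
move=> jP; have [N [g [gl gsum gle g0]]] := c00_tails R.
have /choice[u hu] i := completion_extend jP (gl i) (gle i).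
have [ul ug] := all_and2 hu.
have ugl i x v : g i v - `|x - j v| <= u i x <= g i v + `|x - j v|.
  by rewrite -ler_distl.
have gosc i k v : `|g i v - g k v| <= `|v|.
  wlog ik : i k / (i <= k)%N.
    by move=> w; have [/w//|/ltnW/w] := leqP i k; rewrite distrC.
  by rewrite gsum// interval_norm_ub.
have approx x (e : R) : 0 < e -> exists2 v, `|x - j v| < e & `|v| < `|x| + e.
  move=> e0; have [v xv] := completion_approx jP x e0; exists v => //.
  rewrite -jP.1 -(subKr x (j v)) (le_lt_trans (ler_normB _ _))//.
  by rewrite ltrD2l.
exists u; split.
- exact: ul.
- move=> i x; apply/ler_addgt0Pr => e e0.
  have e2 : 0 < e / 2 by rewrite divr_gt0.
  have [v xv vx] := approx x _ e2.
  have := ler_distD (g i v) (u i x) 0; rewrite !subr0.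
  have := ug i x v; have := gle i v; lra.
- move=> i k x; apply/ler_addgt0Pr => e e0.
  have e3 : 0 < e / 3 by rewrite divr_gt0.
  have [v xv vx] := approx x _ e3.
  have /andP[h1 h2] := ugl i x v; have /andP[h3 h4] := ugl k x v.
  have h5 : g i v - g k v <= `|v| := le_trans (ler_norm _) (gosc i k v).
  lra.
- move=> x r xr; apply/ler_addgt0Pr => e e0.
  have e3 : 0 < e / 3 by rewrite divr_gt0.
  have [v xv] := completion_approx jP x e3.
  have gr i k : g i v - g k v <= r + 2 * (e / 3).
    have /andP[h1 h2] := ugl i x v; have /andP[h3 h4] := ugl k x v.
    have := xr i k; lra.
  have vr : `|v| <= r + 2 * (e / 3).
    apply: interval_norm_le => m n; have [mn|/ltnW nm] := leqP m n.
      rewrite -gsum// ler_norml gr andbT -lerN2 opprK opprB; exact: gr.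
    (* For an empty interval the bound must still be nonnegative, which is [gr] with equal
       indices. *)
    by rewrite big_geq// normr0 -(subrr (g 0 v)); exact: gr.
  rewrite -(subrK (j v) x) (le_trans (ler_normD _ _))// jP.1; lra.
- move=> x; apply/cvgrPdist_lt => e e0.
  have [v xv] := completion_approx jP x e0.
  exists (N v) => // i /= Nvi; rewrite sub0r normrN.
  by have := ug i x v; rewrite g0// subr0 => /le_lt_trans; exact.
Qed.

Theorem theorem3p1 (R : realType) (X : completeNormedModType R)
    (j : {linear c00 R -> X}) (hj : is_completion j) :
  fixed_point_property X.
Proof.
have [u uP] := completion_coordinates hj.
exact: coordinates_fixed_point_property uP.
Qed.
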